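(* For the class of digraphs with $n$ nodes and independence number at most $\alpha$, any $p$-pass streaming algorithm in the insertion-only model for computing a $1$-node or $1$-arc strong connectivity certificate requires $\Omega(\alpha n/p)$ space. Consequently, in both the insertion-only and turnstile models, for every $k$, any $p$-pass streaming algorithm for computing a $k$-node or $k$-arc strong connectivity certificate requires $\Omega(\alpha n/p)$ space.
   Context: All digraphs are simple; the independence number of a digraph is that of its underlying undirected graph. For distinct nodes $s,t$ of $G$, $\kappa_{st}(G)$ (resp. $\lambda_{st}(G)$) is the maximum number of pairwise internally node-disjoint (resp. arc-disjoint) directed $s$–$t$ paths. A $k$-node (resp. $k$-arc) strong connectivity certificate of $G=(V,A)$ is a subgraph $H=(V,A')$ with $A'\subseteq A$ such that $\kappa_{st}(H)\ge\min\{k,\kappa_{st}(G)\}$ (resp. $\lambda_{st}(H)\ge\min\{k,\lambda_{st}(G)\}$) for all distinct $s,t\in V$. Graph streaming model: arcs arrive in adversarial order and the algorithm makes $p$ forward passes; insertion-only model has only insertions, turnstile allows deletions of previously inserted arcs. Space lower bounds are measured in bits. *)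

(* Defs.v *)
From HB Require Import structures.
From mathcomp Require Import all_boot all_order all_algebra.
From mathcomp Require Import reals.

Set Implicit Arguments.
Unset Strict Implicit.
Unset Printing Implicit Defensive.

Import Order.TTheory GRing.Theory Num.Theory.

Section Digraphs.
Variable T : finType.

(* A digraph on the node set T is given by its arc set, so parallel arcs are  *)
(* impossible; antiparallel arcs are allowed.                                 *)
Definition simple_digraph (A : {set T * T}) : bool :=
  [forall x, (x, x) \notin A].

Definition underlying (A : {set T * T}) : rel T :=
  fun x y => ((x, y) \in A) || ((y, x) \in A).

Definition independent (A : {set T * T}) (I : {set T}) : bool :=
  [forall x in I, forall y in I, (x != y) ==> ~~ underlying A x y].

Definition independence_number (A : {set T * T}) : nat :=
  \max_(I : {set T} | independent A I) #|I|.

(* A path is represented by its source s and the sequence q of its remaining  *)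
(* nodes.                                                                     *)
Definition dipath (A : {set T * T}) (s t : T) (q : seq T) : bool :=
  [&& path (fun x y => (x, y) \in A) s q, last s q == t & uniq (s :: q)].

Definition internal_nodes (s t : T) (q : seq T) : seq T :=
  [seq x <- s :: q | (x != s) && (x != t)].

Definition path_arcs (s : T) (q : seq T) : seq (T * T) := zip (s :: q) q.

Definition internally_node_disjoint (s t : T) (q1 q2 : seq T) : bool :=
  ~~ has (mem (internal_nodes s t q1)) (internal_nodes s t q2).

Definition arc_disjoint (s : T) (q1 q2 : seq T) : bool :=
  ~~ has (mem (path_arcs s q1)) (path_arcs s q2).

(* The node sequence of a directed path is duplicate-free, so bounding its    *)
(* length by #|T| excludes no path and makes the type of candidates finite.   *)
Definition disjoint_paths (disj : rel (seq T)) (A : {set T * T}) (s t : T)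
    (F : {set {bseq #|T| of T}}) : bool :=
  [forall q in F, dipath A s t q] &&
  [forall q1 in F, forall q2 in F, (q1 != q2) ==> disj q1 q2].

Definition kappa (A : {set T * T}) (s t : T) : nat :=
  \max_(F : {set {bseq #|T| of T}}
       | disjoint_paths (internally_node_disjoint s t) A s t F) #|F|.

Definition lambda (A : {set T * T}) (s t : T) : nat :=
  \max_(F : {set {bseq #|T| of T}}
       | disjoint_paths (arc_disjoint s) A s t F) #|F|.

Definition node_certificate (k : nat) (A A' : {set T * T}) : bool :=
  (A' \subset A) &&
  [forall s, forall t, (s != t) ==> (minn k (kappa A s t) <= kappa A' s t)].

Definition arc_certificate (k : nat) (A A' : {set T * T}) : bool :=
  (A' \subset A) &&
  [forall s, forall t, (s != t) ==> (minn k (lambda A s t) <= lambda A' s t)].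

End Digraphs.

Inductive connectivity := NodeConn | ArcConn.

Definition certificate (T : finType) (d : connectivity) (k : nat)
    (A A' : {set T * T}) : bool :=
  match d with
  | NodeConn => node_certificate k A A'
  | ArcConn => arc_certificate k A A'
  end.

Inductive update (T : Type) := Insert of T * T | Delete of T * T.

Definition is_insertion (T : Type) (u : update T) : bool :=
  if u is Insert _ then true else false.

(* The arc set reached from A by a stream of updates; None if the stream is   *)
(* ill-formed, i.e. inserts a loop or an arc already present, or deletes an   *)
(* arc not present.                                                           *)
Fixpoint apply_updates (T : finType) (A : {set T * T}) (w : seq (update T)) :
    option {set T * T} :=
  match w with
  | [::] => Some A
  | Insert a :: w' =>
      if (a.1 != a.2) && (a \notin A) then apply_updates (a |: A) w' else None
  | Delete a :: w' =>
      if a \in A then apply_updates (A :\ a) w' else None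
  end.

Inductive stream_model := InsertionOnly | Turnstile.

Definition stream_of (T : finType) (m : stream_model) (A : {set T * T})
    (w : seq (update T)) : Prop :=
  apply_updates set0 w = Some A /\
  match m with
  | InsertionOnly => all (@is_insertion T) w
  | Turnstile => True
  end.

(* The memory always holds S bits and the answer is read off the final memory *)
(* content. The transitions are arbitrary functions and may depend on the     *)
(* index of the current pass at no cost in space.                             *)
Record det_algorithm (T : finType) (S : nat) := DetAlgorithm {
  da_init : S.-tuple bool;
  da_step : nat -> update T -> S.-tuple bool -> S.-tuple bool;
  da_end_pass : nat -> S.-tuple bool -> S.-tuple bool;
  da_output : S.-tuple bool -> {set T * T}
}.

Fixpoint memory_after (T : finType) (S : nat) (a : det_algorithm T S)
    (w : seq (update T)) (p : nat) : S.-tuple bool :=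
  if p is i.+1 then
    da_end_pass a i
      (foldl (fun x u => da_step a i u x) (memory_after a w i) w)
  else da_init a.

Definition det_result (T : finType) (S : nat) (a : det_algorithm T S)
    (p : nat) (w : seq (update T)) : {set T * T} :=
  da_output a (memory_after a w p).

Local Open Scope ring_scope.

(* A randomized algorithm is a probability distribution over deterministic    *)
(* ones; the random seed is not charged to the space.                         *)
Record rand_algorithm (R : realType) (T : finType) (S : nat) := RandAlgorithm {
  ra_seed : finType;
  ra_prob : ra_seed -> R;
  ra_prob_ge0 : forall r, 0 <= ra_prob r;
  ra_prob_sum1 : \sum_r ra_prob r = 1;
  ra_det : ra_seed -> det_algorithm T S
}.

Arguments ra_prob {R T S} _ _.
Arguments ra_det {R T S} _ _.

Definition success_probability (R : realType) (T : finType) (S : nat)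
    (a : rand_algorithm R T S) (p : nat) (w : seq (update T))
    (good : pred {set T * T}) : R :=
  \sum_(r | good (det_result (ra_det a r) p w)) ra_prob a r.

Definition computes_certificate (R : realType) (n S : nat)
    (m : stream_model) (d : connectivity) (k alpha p : nat)
    (a : rand_algorithm R 'I_n S) : Prop :=
  forall (A : {set 'I_n * 'I_n}) (w : seq (update 'I_n)),
    simple_digraph A -> (independence_number A <= alpha)%N ->
    stream_of m A w ->
    2 / 3 <= success_probability a p w (certificate d k A).

(* Main.v *)
Require Import Defs.
From HB Require Import structures.
From mathcomp Require Import all_boot all_order all_algebra.
From mathcomp Require Import reals.
From mathcomp Require Import zify lra.

(** Since the answer is a function of the final memory content, an algorithm
    with [S] bits has at most [2 ^ S] possible answers for each random seed,
    whatever the number of passes.  It is therefore enough to find many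
    digraphs no two of which share a certificate.  Take a digraph [B] of
    independence number at most [alpha] and a set [E] of further arcs, each of
    which is the only arc of [B :|: E] leaving some set of nodes.  For
    [b \subset E], every certificate of [B :|: b] contains [b], because
    reachability along an arc of [b] can only be preserved by that arc; so the
    certificate determines [b], and averaging over [b] gives
    [2 / 3 * 2 ^ #|E| <= 2 ^ S], that is [#|E| <= S].

    For [alpha = 1], [B] is a transitive tournament and [E] consists of the arcs
    from each node to its predecessor.  For [alpha > 1], the nodes are cut into
    linearly ordered blocks of [2 * (alpha %/ 2)] nodes, [B] has all the arcs
    from a block to a later one, and [E] all the arcs from the first half of a
    block to its second half. *)

Set Implicit Arguments.
Unset Strict Implicit.
Unset Printing Implicit Defensive.

Import Order.TTheory GRing.Theory Num.Theory.
Local Open Scope ring_scope.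

(** * Certificates and one-arc directed cuts *)

Section Certificates.
Variable T : finType.
Implicit Types (A B E b : {set T * T}) (C : {set T}).

Lemma max_disjoint_paths_arc_gt0 (disj : rel (seq T)) A s t :
  (s, t) \in A -> s != t ->
  (0 < \max_(F : {set {bseq #|T| of T}} | disjoint_paths disj A s t F) #|F|)%N.
Proof.
move=> stA neq_st.
have sz1 : (size [:: t] <= #|T|)%N by apply/card_gt0P; exists t.
pose F : {set {bseq #|T| of T}} := [set Bseq sz1].
suff FP : disjoint_paths disj A s t F.
  by apply: leq_trans (leq_bigmax_cond _ FP); rewrite cards1.
apply/andP; split.
  apply/forall_inP => q /set1P ->.
  by rewrite /dipath /= stA eqxx inE neq_st.
apply/forall_inP => q1 /set1P ->; apply/forall_inP => q2 /set1P ->.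
by rewrite eqxx.
Qed.

Lemma max_disjoint_paths_gt0_dipath (disj : rel (seq T)) A s t :
  (0 < \max_(F : {set {bseq #|T| of T}} | disjoint_paths disj A s t F) #|F|)%N ->
  exists q, dipath A s t q.
Proof.
case: (pickP (fun F : {set {bseq #|T| of T}} =>
                disjoint_paths disj A s t F && (F != set0))) => [F|noF].
  case/andP=> /andP[/forall_inP pathF _] /set0Pn[q qF] _.
  by exists q; apply: pathF.
rewrite big1 // => F FP; apply/eqP; rewrite cards_eq0.
by have := noF F; rewrite FP /= => /negbFE.
Qed.

Lemma certificate_sub d k A A' : certificate d k A A' -> A' \subset A.
Proof. by case: d => /andP[]. Qed.

(** For [k] positive, an arc makes [minn k] of the connectivity positive, whichever disjointness
    notion is used. Only reachability matters from here on, so node and arc certificates and all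
    such [k] are treated alike. *)
Lemma certificate_dipath d k A A' s t :
  (0 < k)%N -> certificate d k A A' -> (s, t) \in A -> s != t ->
  exists q, dipath A' s t q.
Proof.
move=> k_gt0 certA stA neq_st.
case: d certA => /andP[_ /forallP/(_ s)/forallP/(_ t)]; rewrite neq_st /=;
  move=> le_min; apply: max_disjoint_paths_gt0_dipath;
  apply: leq_trans le_min; rewrite leq_min k_gt0 /=;
  exact: max_disjoint_paths_arc_gt0.
Qed.

Lemma path_leaves A C s q :
  path (fun x y => (x, y) \in A) s q -> s \in C -> last s q \notin C ->
  exists e, [/\ e \in A, e.1 \in C & e.2 \notin C].
Proof.
elim: q s => [|x q IHq] s /=; first by move=> _ ->.
case/andP=> sxA pathq sC lastC; have [xC|xC] := boolP (x \in C).
  exact: IHq pathq xC lastC.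
by exists (s, x).
Qed.

(** The set [C] is a directed cut crossed by [e] alone, so every path of [A] from [e.1] to [e.2]
    must use [e]. *)
Definition sole_leaving_arc A (e : T * T) : Prop :=
  exists C, [/\ e.1 \in C, e.2 \notin C &
    forall f, f \in A -> f.1 \in C -> f.2 \notin C -> f = e].

Lemma sole_leaving_arc_sub A A' e :
  A' \subset A -> sole_leaving_arc A e -> sole_leaving_arc A' e.
Proof.
move=> /subsetP subA [C [e1C e2C soleC]].
by exists C; split=> // f /subA; apply: soleC.
Qed.

Lemma sole_leaving_arc_neq A e : sole_leaving_arc A e -> e.1 != e.2.
Proof. by case=> C [e1C e2C _]; apply: contraNneq e2C => <-. Qed.

Lemma certificate_sole_leaving_arc d k A A' e :
  (0 < k)%N -> certificate d k A A' -> e \in A -> sole_leaving_arc A e ->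
  e \in A'.
Proof.
move=> k_gt0 certA eA sole_e; have neq_e := sole_leaving_arc_neq sole_e.
case: e => s t /= in eA sole_e neq_e *.
have [q /and3P[pathq /eqP lastq _]] := certificate_dipath k_gt0 certA eA neq_e.
case: sole_e => C [/= sC tC soleC].
rewrite -lastq in tC; have [f [fA' f1C f2C]] := path_leaves pathq sC tC.
rewrite -lastq in soleC *; rewrite -(soleC f) //.
exact: subsetP (certificate_sub certA) f fA'.
Qed.

Lemma certificate_determines d k B E b A' :
  (0 < k)%N -> [disjoint B & E] ->
  {in E, forall e, sole_leaving_arc (B :|: E) e} ->
  b \subset E -> certificate d k (B :|: b) A' -> A' :&: E = b.
Proof.
move=> k_gt0 disBE soleE /subsetP sub_bE certA.
apply/setP => e; rewrite inE; apply/andP/idP => [[eA' eE]|eb].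
  have := subsetP (certificate_sub certA) e eA'; rewrite inE => /orP[eB|//].
  by have := disjointFr disBE eB; rewrite eE.
split; last exact: sub_bE.
apply: certificate_sole_leaving_arc k_gt0 certA _ _; first by rewrite inE eb orbT.
apply: sole_leaving_arc_sub (soleE e (sub_bE e eb)).
by apply: setUS; apply/subsetP.
Qed.

Lemma independence_number_sub A A' :
  A \subset A' -> (independence_number A' <= independence_number A)%N.
Proof.
move=> /subsetP subA; apply/bigmax_leqP => I indI.
apply: leq_bigmax_cond; apply/forall_inP => x xI; apply/forall_inP => y yI.
apply/implyP => neq_xy; have /forall_inP/(_ y yI) := forall_inP indI x xI.
rewrite neq_xy /=; apply: contra => /orP[]/subA arcA'.
  by rewrite /underlying arcA'.
by rewrite /underlying arcA' orbT.
Qed.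

Lemma apply_updates_insert (s : seq (T * T)) A :
  uniq s -> {in s, forall a, a.1 != a.2 /\ a \notin A} ->
  apply_updates A [seq Insert a | a <- s] = Some (A :|: [set a in s]).
Proof.
elim: s A => [|a s IHs] A /=.
  by move=> _ _; congr Some; apply/setP => x; rewrite !inE orbF.
case/andP=> a_s uniq_s okA.
have [-> ->] := okA a (mem_head _ _); rewrite /= IHs //.
  by congr Some; apply/setP => x; rewrite !inE orbCA orbA.
move=> x xs; have [neq_x xA] := okA x (mem_behead (s := a :: s) xs).
by split=> //; rewrite !inE negb_or xA andbT; apply: contraNneq a_s => <-.
Qed.

(** A stream of insertions is legal in both models, so the same hard inputs serve insertion-only and
    turnstile algorithms. *)
Lemma stream_of_enum m A :
  simple_digraph A -> stream_of m A [seq Insert a | a <- enum A].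
Proof.
move=> /forallP simpleA; split.
  rewrite apply_updates_insert ?enum_uniq //.
    by congr Some; apply/setP => x; rewrite !inE mem_enum.
  case=> x y; rewrite mem_enum inE => xyA; split=> //=.
  by apply: contraTneq xyA => ->.
by case: m => //; elim: (enum A).
Qed.

End Certificates.

(** * Counting inputs against memory contents *)

(** For a fixed seed, the final memory is injective on the indices where the run succeeds, since an
    answer is good for one index at most; hence at most [2 ^ S] successes. Summing the success
    probabilities over indices and exchanging with the sum over seeds gives the bound. *)
Lemma card_encodings (R : realType) (T I : finType) (S p : nat)
    (a : rand_algorithm R T S) (w : I -> seq (update T))
    (good : I -> pred {set T * T}) :
  (forall i j X, good i X -> good j X -> i = j) ->
  (forall i, 2 / 3 <= success_probability a p (w i) (good i)) ->
  2 / 3 * #|I|%:R <= 2 ^+ S :> R.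
Proof.
move=> goodI succ.
pose ok r i := good i (det_result (ra_det a r) p (w i)).
have card_ok r : (#|[set i | ok r i]| <= 2 ^ S)%N.
  rewrite -[2%N]card_bool -card_tuple.
  pose f i := memory_after (ra_det a r) (w i) p.
  rewrite -(@card_in_imset _ _ f) ?max_card // => i j; rewrite !inE /ok /det_result.
  by rewrite -/(f i) -/(f j) => + + eq_f; rewrite eq_f => /goodI; apply.
apply: (@le_trans _ _ (\sum_i success_probability a p (w i) (good i))).
  rewrite mulr_natr -sumr_const.
  by apply: ler_sum => i _; apply: succ.
under eq_bigr do rewrite /success_probability big_mkcond /=.
have -> : 2 ^+ S = \sum_r ra_prob a r * 2 ^+ S.
  by rewrite -mulr_suml ra_prob_sum1 mul1r.
rewrite exchange_big; apply: ler_sum => r _.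
rewrite -big_mkcond /= sumr_const -[leLHS]mulr_natr.
apply: ler_wpM2l; first exact: ra_prob_ge0.
by rewrite -natrX ler_nat; have := card_ok r; rewrite cardsE.
Qed.

Lemma card_sole_leaving_arcs_le (R : realType) (n S : nat) m d k alpha p
    (a : rand_algorithm R 'I_n S) (B E : {set 'I_n * 'I_n}) :
  (0 < k)%N -> computes_certificate m d k alpha p a ->
  simple_digraph B -> (independence_number B <= alpha)%N ->
  [disjoint B & E] -> {in E, forall e, sole_leaving_arc (B :|: E) e} ->
  (#|E| <= S)%N.
Proof.
move=> k_gt0 compa simpleB indB disBE soleE.
pose I := {b : {set 'I_n * 'I_n} | b \in powerset E}.
pose G (i : I) := B :|: val i.
have subE (i : I) : val i \subset E by rewrite -powersetE; apply: valP.
have simpleG i : simple_digraph (G i).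
  apply/forallP => x; rewrite inE negb_or (forallP simpleB) /=.
  apply/negP => /(subsetP (subE i))/soleE/sole_leaving_arc_neq.
  by rewrite eqxx.
have : 2 / 3 * #|{: I}|%:R <= 2 ^+ S :> R.
  apply: (@card_encodings R _ _ S p a
           (fun i => [seq Insert e | e <- enum (G i)])
           (fun i => certificate d k (G i))).
    move=> i j X certi certj; apply: val_inj.
    rewrite -(certificate_determines k_gt0 disBE soleE (subE i) certi).
    exact: (certificate_determines k_gt0 disBE soleE (subE j) certj).
  move=> i; apply: compa => //; last exact: stream_of_enum.
  by apply: leq_trans indB; apply: independence_number_sub; apply: subsetUl.
rewrite card_sig card_powerset natrX => le_pow.
(* With one more arc than bits, the left side would be at least [4 / 3 * 2 ^+ S]. *)
rewrite leqNgt; apply/negP => lt_SE.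
have := @ler_weXn2l R 2 _ _ _ lt_SE; rewrite exprS => /(_ ltac:(by rewrite ler1n)).
have : 0 < 2 ^+ S :> R by apply: exprn_gt0.
lra.
Qed.

(** * Ordered blocks, for independence number above one *)

Section OrderedBlocks.
Variables (T : finType) (block : T -> nat) (first_half : pred T).

Definition inter_block_arcs : {set T * T} := [set e | (block e.1 < block e.2)%N].

Definition intra_block_arcs : {set T * T} :=
  [set e | [&& block e.1 == block e.2, first_half e.1 & ~~ first_half e.2]].

Lemma simple_inter_block_arcs : simple_digraph inter_block_arcs.
Proof. by apply/forallP => x; rewrite inE /= ltnn. Qed.

(** Nodes of different blocks are adjacent, so an independent set lies within a single block. *)
Lemma independence_number_inter_block_arcs alpha :
  (forall t, #|[set x | block x == t]| <= alpha)%N ->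
  (independence_number inter_block_arcs <= alpha)%N.
Proof.
move=> card_block; apply/bigmax_leqP => I indI.
have [->|[x xI]] := set_0Vmem I; first by rewrite cards0.
apply: leq_trans (card_block (block x)); apply/subset_leq_card/subsetP => y yI.
rewrite inE; have [->//|neq_yx] := eqVneq y x.
have /forall_inP/(_ x xI) := forall_inP indI y yI.
by rewrite neq_yx /= /underlying !inE /= negb_or -!leqNgt andbC -eqn_leq.
Qed.

Lemma disjoint_inter_intra : [disjoint inter_block_arcs & intra_block_arcs].
Proof.
rewrite disjoint_subset; apply/subsetP => e; rewrite !inE.
by case: ltngtP.
Qed.

Lemma sole_leaving_intra_block_arc :
  {in intra_block_arcs, forall e,
     sole_leaving_arc (inter_block_arcs :|: intra_block_arcs) e}.
Proof.
case=> u v; rewrite inE /= => /and3P[/eqP eq_uv uL vL].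
(* The cut holds [u], all later blocks, and the second half of the block of [u] except [v]. An
   inter-block arc leads to a later block and cannot leave it; an intra-block arc leaving it must
   start at [u], and the only second-half node of that block outside is [v]. *)
exists [set x | [|| x == u, (block u < block x)%N |
                 [&& block x == block u, ~~ first_half x & x != v]]].
split; rewrite ?inE /= ?eqxx //.
  by rewrite eq_uv ltnn /= !andbF orbF; apply: contraNneq vL => ->.
case=> x y; rewrite !inE /= => arc_xy xC; rewrite !negb_or -leqNgt.
case/and3P=> neq_yu le_yu; rewrite !negb_and negbK => yC.
have le_ux : (block u <= block x)%N.
  by case/or3P: xC => [/eqP->|/ltnW|/and3P[/eqP-> _ _]].
case/orP: arc_xy => [lt_xy|/and3P[/eqP eq_xy xL yL]].
  by have := leq_trans (leq_ltn_trans le_ux lt_xy) le_yu; rewrite ltnn.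
move: xC yC; rewrite xL /= andbF orbF (negPf yL) /= eq_xy.
rewrite ltnNge le_yu orbF => /eqP eq_xu.
by rewrite -eq_xy eq_xu eqxx /= negbK => /eqP ->.
Qed.

End OrderedBlocks.

Lemma card_block_le n c t : (0 < c)%N -> (#|[set x : 'I_n | x %/ c == t]| <= c)%N.
Proof.
move=> c_gt0; pose f (x : 'I_n) := Ordinal (ltn_pmod x c_gt0).
rewrite -[leqRHS]card_ord -(@card_in_imset _ _ f) ?max_card // => x y.
rewrite !inE => /eqP xt /eqP yt /(congr1 val) /= eq_mod; apply: val_inj.
by rewrite /= (divn_eq x c) (divn_eq y c) xt yt eq_mod.
Qed.

Lemma card_intra_block_arcs n m : (0 < m)%N ->
  (n %/ (2 * m) * m * m <=
   #|intra_block_arcs (fun x : 'I_n => x %/ (2 * m))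
                      (fun x : 'I_n => x %% (2 * m) < m)|)%N.
Proof.
move=> m_gt0; set q := (n %/ _)%N; set E := intra_block_arcs _ _.
have node_lt (t : 'I_q) i : (i < 2 * m -> t * (2 * m) + i < n)%N.
  move=> lt_i; have := leq_trunc_div n (2 * m); rewrite -/q.
  have := ltn_ord t; nia.
have lt1 (i : 'I_m) : (i < 2 * m)%N by have := ltn_ord i; lia.
have lt2 (j : 'I_m) : (m + j < 2 * m)%N by have := ltn_ord j; lia.
(* The triple [(t, i, j)] encodes the arc from the [i]-th node of the first half of block [t] to the
   [j]-th node of its second half. Only the [q] full blocks are counted. *)
pose f (z : 'I_q * 'I_m * 'I_m) :=
  (Ordinal (node_lt z.1.1 _ (lt1 z.1.2)), Ordinal (node_lt z.1.1 _ (lt2 z.2))).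
have f_inj : injective f.
  move=> [[t i] j] [[t' i'] j'] [/= eq1 eq2].
  have := lt1 i; have := lt1 i'; have := lt2 j; have := lt2 j' => *.
  have eq_t : t = t' :> nat.
    by move/(congr1 (divn^~ (2 * m)%N)): eq1; rewrite !divnMDl ?divn_small //; lia.
  rewrite eq_t in eq1 eq2; move/addnI: eq1 => eq_i; move/addnI/addnI: eq2 => eq_j.
  by congr (_, _, _); apply: val_inj.
have -> : (q * m * m = #|[set: 'I_q * 'I_m * 'I_m]|)%N.
  by rewrite cardsT !card_prod !card_ord.
rewrite -(card_imset _ f_inj); apply/subset_leq_card/subsetP => _ /imsetP[z _ ->].
have := lt1 z.1.2; have := lt2 z.2 => z2 z1.
rewrite inE /= !divnMDl ?muln_gt0 // !divn_small // eqxx !modnMDl !modn_small //.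
by rewrite ltn_ord -leqNgt leq_addr.
Qed.

(** * The transitive tournament, for independence number one *)

Section Tournament.
Variable n : nat.

Definition forward_arcs : {set 'I_n * 'I_n} := [set e : 'I_n * 'I_n | (e.1 < e.2)%N].
Definition predecessor_arcs : {set 'I_n * 'I_n} :=
  [set e : 'I_n * 'I_n | e.1 == e.2.+1 :> nat].

Lemma independence_number_forward_arcs :
  (independence_number forward_arcs <= 1)%N.
Proof.
apply: (@independence_number_inter_block_arcs _ (@nat_of_ord n)) => t.
by apply/card_le1P => x; rewrite inE => /eqP <- y; rewrite !inE.
Qed.

Lemma disjoint_forward_predecessor : [disjoint forward_arcs & predecessor_arcs].
Proof. by rewrite disjoint_subset; apply/subsetP => e; rewrite !inE; lia. Qed.

Lemma sole_leaving_predecessor_arc :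
  {in predecessor_arcs, forall e,
     sole_leaving_arc (forward_arcs :|: predecessor_arcs) e}.
Proof.
case=> u v; rewrite inE /= => /eqP eq_uv.
(* Forward arcs cannot leave an upper set, and a predecessor arc drops by one, so it can leave only
   from the least element [u]. *)
exists [set x : 'I_n | (u <= x)%N]; split; rewrite ?inE //=; first by lia.
case=> x y; rewrite !inE /= => arc_xy le_ux lt_yu.
by congr (_, _); apply: val_inj => /=; lia.
Qed.

Lemma card_predecessor_arcs : (n.-1 <= #|predecessor_arcs|)%N.
Proof.
have lt1 (i : 'I_n.-1) : (i.+1 < n)%N by have := ltn_ord i; lia.
have lt0 (i : 'I_n.-1) : (i < n)%N by have := ltn_ord i; lia.
pose f i := (Ordinal (lt1 i), Ordinal (lt0 i)).
have f_inj : injective f by move=> i j [_ eq_ij]; apply: val_inj.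
rewrite -[leqLHS]card_ord -cardsT -(card_imset _ f_inj).
by apply/subset_leq_card/subsetP => _ /imsetP[i _ ->]; rewrite inE.
Qed.

End Tournament.

(** * The space bound *)

Lemma certificate_space_ge (R : realType) m k n alpha p S d
    (a : rand_algorithm R 'I_n S) :
  (0 < k)%N -> (2 <= n)%N -> (0 < alpha <= n)%N ->
  computes_certificate m d k alpha p a -> (alpha * n <= 12 * S)%N.
Proof.
move=> k_gt0 n_ge2 /andP[alpha_gt0 le_alpha] compa.
have [alpha1|alpha_gt1] := leqP alpha 1.
  have := card_sole_leaving_arcs_le k_gt0 compa
    (simple_inter_block_arcs (@nat_of_ord n))
    (leq_trans (independence_number_forward_arcs n) alpha_gt0)
    (disjoint_forward_predecessor n) (@sole_leaving_predecessor_arc n).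
  move/(leq_trans (card_predecessor_arcs n)).
  by rewrite (_ : alpha = 1%N) ?mul1n; lia.
pose h := (alpha %/ 2)%N; have h_gt0 : (0 < h)%N by rewrite /h; lia.
pose block (x : 'I_n) := (x %/ (2 * h))%N.
pose half (x : 'I_n) := (x %% (2 * h) < h)%N.
have indB : (independence_number (inter_block_arcs block) <= alpha)%N.
  apply: independence_number_inter_block_arcs => t.
  by apply: leq_trans (card_block_le _ _ _) _; rewrite /h; lia.
have := card_sole_leaving_arcs_le k_gt0 compa (simple_inter_block_arcs block)
  indB (disjoint_inter_intra block half)
  (@sole_leaving_intra_block_arc _ block half).
move/(leq_trans (card_intra_block_arcs n h_gt0)).
have c_gt0 : (0 < 2 * h)%N by lia.
(* The constant 12 is [3 * 4]: rounding gives [alpha <= 3 * h], tight at [alpha = 3], and since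
   there is at least one full block, [n < 2 * h * q.+1 <= 4 * h * q]. The arcs number at least
   [q * h * h]. *)
have le_q : (1 <= n %/ (2 * h))%N by rewrite divn_gt0 // /h; lia.
have lt_n := ltn_ceil n c_gt0.
have le_alpha3 : (alpha <= 3 * h)%N by rewrite /h; lia.
set q := (n %/ _)%N in le_q lt_n * => le_S.
have le_n : (n <= 4 * h * q)%N by nia.
by have := leq_mul le_alpha3 le_n; nia.
Qed.

Theorem theorem1p5 (R : realType) :
  (exists c : R, 0 < c /\ exists n0 : nat,
     forall (n alpha p S : nat) (d : connectivity)
            (a : rand_algorithm R 'I_n S),
       (n0 <= n)%N -> (0 < alpha <= n)%N -> (0 < p)%N ->
       computes_certificate InsertionOnly d 1 alpha p a ->
       c * (alpha%:R * n%:R / p%:R) <= S%:R)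
  /\
  (exists c : R, 0 < c /\ exists n0 : nat,
     forall (m : stream_model) (k n alpha p S : nat) (d : connectivity)
            (a : rand_algorithm R 'I_n S),
       (0 < k)%N -> (n0 <= n)%N -> (0 < alpha <= n)%N -> (0 < p)%N ->
       computes_certificate m d k alpha p a ->
       c * (alpha%:R * n%:R / p%:R) <= S%:R).
Proof.
have bound (m : stream_model) (k n alpha p S : nat) (d : connectivity)
    (a : rand_algorithm R 'I_n S) :
    (0 < k)%N -> (2 <= n)%N -> (0 < alpha <= n)%N -> (0 < p)%N ->
    computes_certificate m d k alpha p a ->
    12^-1 * (alpha%:R * n%:R / p%:R) <= S%:R :> R.
  move=> k_gt0 n_ge2 alpha_n p_gt0 compa.
  rewrite mulrC ler_pdivrMr ?ltr0n //.
  (* The bound proved is free of [p]; dividing by [p] only weakens it. *)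
  apply: (@le_trans _ _ (alpha * n)%:R).
    by rewrite ler_pdivrMr ?ltr0n // -!natrM ler_nat leq_pmulr.
  by rewrite -natrM ler_nat [leqRHS]mulnC; apply: certificate_space_ge compa.
have c_gt0 : 0 < 12^-1 :> R by rewrite invr_gt0 ltr0n.
split; exists 12^-1; split=> //; exists 2; last exact: bound.
by move=> n alpha p S d a; apply: (bound _ 1).
Qed.
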